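(* Let $(V,\top)$ be a locality vector space and $W\subset V$ a linear subspace which is locality compatible with $\top$. Then $(V/W,\overline\top)$ is a locality vector space, where $\overline\top$ is the quotient locality.
   Context: The ground field is $\mathbb{R}$ or $\mathbb{C}$. A locality vector space is a vector space $V$ with a symmetric relation $\top\subset V\times V$ containing $(0,0)$ such that for every subset $U\subset V$ the polar set $U^\top=\{x\in V: x\top u\ \forall u\in U\}$ is a linear subspace. A subspace $W$ is locality compatible with $\top$ if for all $(x,y,z)\in V^3$ and $w\in W$ with $x\top y$ and $(x+w)\top z$, there exists $w'\in W$ with $(x+w')\top y$ and $(x+w')\top z$. The quotient locality $\overline\top$ on $V/W$: $[u]\,\overline\top\,[v]$ iff there exist $u'\in[u]$, $v'\in[v]$ with $u'\top v'$. *)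

(* Defs.v *)
From HB Require Import structures.
From mathcomp Require Import all_boot all_order all_algebra.
From mathcomp Require Import boolp classical_sets reals.
From mathcomp Require Import complex.

Set Implicit Arguments.
Unset Strict Implicit.
Unset Printing Implicit Defensive.

Import GRing.Theory.
Local Open Scope ring_scope.
Local Open Scope quotient_scope.
Local Open Scope classical_set_scope.

Variant real_or_complex : fieldType -> Prop :=
  | RealGround (R : realType) : real_or_complex R
  | ComplexGround (R : realType) : real_or_complex R[i].

Section QuotientSpace.
Variables (K : fieldType) (V : lmodType K) (W : submodClosed V).

(* [submodClosed] is defined over semirings and so lacks closure under
   opposite, which the quotient of an additive group expects. *)
Fact subspace_oppr_closed : oppr_closed W.
Proof. by move=> x Wx; rewrite -scaleN1r rpredZ. Qed.

Definition subspace_zmod : zmodClosed V :=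
  HB.pack (GRing.SubmodClosed.sort W)
    (GRing.isOppClosed.Build V W subspace_oppr_closed).

Definition quot_space : Type := Quotient.quot subspace_zmod.
HB.instance Definition _ := GRing.Zmodule.on quot_space.
HB.instance Definition _ := EqQuotient.on quot_space.

Lemma eqmod_subspace (x y : V) : (x - y \in W) = (x == y %[mod quot_space]).
Proof. exact: (Quotient.idealrBE subspace_zmod). Qed.

Lemma pi_addq : {morph \pi_quot_space : x y / x + y}.
Proof. exact: (Quotient.pi_add subspace_zmod). Qed.

Definition scaleq (a : K) := lift_op1 quot_space ( *:%R a).

Lemma pi_scaleq a : {morph \pi_quot_space : x / a *: x >-> scaleq a x}.
Proof.
move=> x; unlock scaleq; apply/eqP; rewrite -eqmod_subspace -scalerBr rpredZ //.
by rewrite eqmod_subspace reprK.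
Qed.

Fact scaleqA a b q : scaleq a (scaleq b q) = scaleq (a * b) q.
Proof. by rewrite -[q]reprK -!pi_scaleq scalerA. Qed.

Fact scale1q : left_id 1 scaleq.
Proof. by move=> q; rewrite -[q]reprK -pi_scaleq scale1r. Qed.

Fact scaleqDr : right_distributive scaleq +%R.
Proof.
move=> a p q; rewrite -[p]reprK -[q]reprK.
by rewrite -pi_addq -!pi_scaleq -pi_addq scalerDr.
Qed.

Fact scaleqDl q : {morph scaleq^~ q : a b / a + b}.
Proof. by move=> a b; rewrite -[q]reprK -!pi_scaleq -pi_addq scalerDl. Qed.

HB.instance Definition _ := GRing.Zmodule_isLmodule.Build K quot_space
  scaleqA scale1q scaleqDr scaleqDl.

End QuotientSpace.

Section Locality.
Variables (K : fieldType) (V : lmodType K).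
Implicit Types (T : V -> V -> Prop) (W : submodClosed V).

Definition polar T (U : set V) : set V := [set x | forall u, U u -> T x u].

Record locality_space T : Prop := LocalitySpace {
  locality_sym : forall x y, T x y -> T y x;
  locality_00 : T 0 0;
  locality_polar : forall U : set V, submod_closed [in polar T U] }.

Definition locality_compatible T W : Prop :=
  forall x y z w, w \in W -> T x y -> T (x + w) z ->
    exists2 w', w' \in W & T (x + w') y /\ T (x + w') z.

Definition quot_locality T W (p q : quot_space W) : Prop :=
  exists u v, [/\ \pi_(quot_space W) u = p, \pi_(quot_space W) v = q & T u v].

End Locality.

Arguments quot_locality {K V} T W p q.

(* Main.v *)
Require Import Defs.
From HB Require Import structures.
From mathcomp Require Import all_boot all_order all_algebra.
From mathcomp Require Import boolp classical_sets reals.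

(** A polar set is the intersection of the polar sets of its points, so a
    symmetric relation containing the pair of zeros is a locality as soon as,
    for each fixed [v], the elements related to [v] form a subspace
    ([locality_spaceP]).  In the quotient only stability of this set under
    sums is delicate: if [p1] and [p2] are both related to [q], the two
    witnessing pairs use representatives of [q] that may differ by some
    [w \in W].  Compatibility is what replaces them by a common
    representative of [q], and then the sum is taken upstairs, inside one
    polar set of [V]. *)

Import GRing.Theory.
Local Open Scope ring_scope.
Local Open Scope quotient_scope.

Section LocalityPointwise.
Variables (K : fieldType) (V : lmodType K) (T : V -> V -> Prop).

Lemma polar_linear (U : set V) : locality_space T ->
  polar T U 0 /\
  forall a x y, polar T U x -> polar T U y -> polar T U (a *: x + y).
Proof.
case=> _ _ /(_ U)[/set_mem U0 UD]; split=> // a x y Ux Uy.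
by apply/set_mem/UD; apply/mem_set.
Qed.

Lemma locality0l v : locality_space T -> T 0 v.
Proof. by case/(polar_linear [set v]%classic) => /(_ v erefl). Qed.

Lemma localityPl a x y v : locality_space T ->
  T x v -> T y v -> T (a *: x + y) v.
Proof.
case/(polar_linear [set v]%classic) => _ Tlin xv yv.
by apply: (Tlin a x y _ _ v erefl) => _ ->.
Qed.

(** Since [polar T U] is cut out by one condition for each [u] in [U], and
    linear conditions are stable under intersection, singletons suffice. *)
Lemma locality_spaceP : (forall x y, T x y -> T y x) -> (forall v, T 0 v) ->
  (forall a x y v, T x v -> T y v -> T (a *: x + y) v) -> locality_space T.
Proof.
move=> Tsym T0 Tlin; split=> // U; split; first by apply/mem_set => u _.
move=> a x y /set_mem Ux /set_mem Uy; apply/mem_set => u Uu.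
by apply: Tlin; [apply: Ux | apply: Uy].
Qed.

End LocalityPointwise.

Theorem theorem6p12 (K : fieldType) (hK : real_or_complex K) (V : lmodType K)
    (T : V -> V -> Prop) (W : submodClosed V) :
  locality_space T -> locality_compatible T W ->
  locality_space (quot_locality T W).
Proof.
move=> locT compatW; have Tsym := locality_sym locT.
apply: locality_spaceP => [p q [u [v [<- <- /Tsym vu]]]|q|a p1 p2 q].
- by exists v, u.
- exists 0, (repr q); split; [|exact: reprK|exact: locality0l].
  by apply: (addrI (\pi 0)); rewrite -pi_addq !addr0.
move=> [u1 [v1 [<- <- /Tsym v1u1]]] [u2 [v2 [<- /eqP]]].
rewrite -eqmod_subspace => Wv /Tsym v2u2.
(* Compatibility, pivoting on [v1] with [v2 - v1] as the discrepancy, yields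
   a representative [v1 + w] of [q] related to both [u1] and [u2]. *)
have v1wu2 : T (v1 + (v2 - v1)) u2 by rewrite addrC subrK.
have [w Ww [/Tsym u1w /Tsym u2w]] := compatW _ _ _ _ Wv v1u1 v1wu2.
exists (a *: u1 + u2), (v1 + w); split; last exact: localityPl.
- by rewrite pi_addq pi_scaleq.
- by apply/eqP; rewrite -eqmod_subspace addrAC subrr add0r.
Qed.
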